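(* Let $b,c$ be nonperiodic kneading sequences with $b_1=0$ and $c_1=1$, let $t\in(\frac12,t_2]$ (where $t_2=\frac{\sqrt5-1}2$) be the smallest parameter for which $x_b(t)=x_c(t)=:y$, and suppose that the $G$-orbit of $y$ (for this parameter $t$) does not return to $D=[1-t,t]$. Let $\beta=1/t$. Then $y$ has exactly two addresses, the local dimension of $\nu_t$ at $y$ assumes its maximal value $\log2/\log\beta$, and the density of $\nu_t$ at $y$ is zero. All points in $D$ with two addresses are obtained in this way.
   Context: A 01-sequence $b_1b_2\dots$ is identified with the binary number $b=.b_1b_2\dots=\sum_k b_k2^{-k}$. It is called an itinerary if the closure of its orbit under the doubling map $x\mapsto2x\bmod1$ (acting as the shift) does not contain $\frac12$. A (non-constant) itinerary $b$ is a kneading sequence if no number $.b_kb_{k+1}\dots$, $k\ge1$, is nearer to $\frac12$ than $b$. ''Nonperiodic'' means not purely periodic. The address curve of $b$ is $x_b(t)=\frac{1-t}{t}\sum_{k\ge1}b_kt^k$. For $t\in(\frac12,1)$, $\beta=1/t$, let $g_0:[0,t]\to[0,1]$, $g_0(x)=\beta x$, and $g_1:[1-t,1]\to[0,1]$, $g_1(x)=\beta x+1-\beta$; $G(x)$ is the set of those of $g_0(x),g_1(x)$ which are defined, and $G^q(x)=G(G^{q-1}(x))$. That the $G$-orbit of $y$ does not return to $D$ means $G^q(y)\cap D=\emptyset$ for all $q\ge1$. A 01-sequence $s$ is an address of $x$ (for the parameter $t$) if $x=\frac{1-t}{t}\sum_{k\ge1}s_kt^k$. The Bernoulli convolution $\nu_t$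 is the unique Borel probability measure on $[0,1]$ with $\nu_t(A)=\frac12\nu_t(g_0(A))+\frac12\nu_t(g_1(A))$ for Borel $A\subset[0,1]$, where $g_i(A)$ is the image of the intersection of $A$ with the domain of $g_i$. The local dimension of $\nu_t$ at $y$ is $\lim_{r\to0}\frac{\log\nu_t[y-r,y+r]}{\log r}$, and the density at $y$ is $\lim_{\epsilon\to0}\frac{\nu_t[y-\epsilon,y+\epsilon]}{2\epsilon}$.
   Formalization: In the last sentence, at the endpoints of D the sequence b=0111... (if y=t) or c=1000... (if y=1-t) is allowed in place of a nonperiodic kneading sequence, since these forced addresses have binary number 1/2 and are not itineraries; at other points of D the claim is as stated. *)

(* Defs.v *)
From mathcomp Require Export all_boot all_order all_algebra.
From mathcomp Require Export all_classical all_reals all_analysis.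
Export Order.TTheory GRing.Theory Num.Theory.
Export numFieldNormedType.Exports.

Set Implicit Arguments.
Unset Strict Implicit.
Unset Printing Implicit Defensive.

Local Open Scope classical_set_scope.
Local Open Scope ring_scope.

(* A 01-sequence b_1 b_2 ... is indexed from 0: the digit b_(k+1) is [b k]. *)
Definition seq01 := nat -> bool.

Definition shift (k : nat) (b : seq01) : seq01 := fun n => b (k + n)%N.

Definition constant01 (b : seq01) : Prop := exists d : bool, forall k, b k = d.

Definition purely_periodic (b : seq01) : Prop :=
  exists p : nat, (0 < p)%N /\ forall k, b (p + k)%N = b k.

Section Sequences.
Variable R : realType.
Implicit Types (b s : seq01) (x t : R).

(* The binary number .b_1 b_2 ... *)
Definition binary b : R := limn (series (fun k => (b k)%:R * 2^-1 ^+ k.+1 : R)).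

(* The doubling map acts on binary numbers as the shift; in particular
   .111... = 1 is fixed. *)
Definition itinerary b : Prop :=
  ~ closure [set binary (shift k b) | k in [set: nat]] (2^-1 : R).

Definition kneading b : Prop :=
  [/\ itinerary b, ~ constant01 b &
      forall k, ~ (`|binary (shift k b) - 2^-1| < `|binary b - 2^-1|)].

Definition address_curve b t : R :=
  (1 - t) / t * limn (series (fun k => (b k)%:R * t ^+ k.+1 : R)).

Definition is_address t x s : Prop := x = address_curve s t.

Definition exactly_two_addresses t x : Prop :=
  exists s1 s2 : seq01, s1 <> s2 /\ [set s | is_address t x s] = [set s1; s2].

Definition t2 : R := (Num.sqrt 5 - 1) / 2.

Definition smallest_crossing b c t : Prop :=
  [/\ 2^-1 < t < 1, address_curve b t = address_curve c t &
      forall s : R, 2^-1 < s < t -> address_curve b s <> address_curve c s].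

End Sequences.

Section MultivaluedMap.
Variable R : realType.
Implicit Types (t x y : R) (A : set R).

Definition g0 t x : R := t^-1 * x.
Definition g1 t x : R := t^-1 * x + 1 - t^-1.
Definition dom_g0 t : set R := `[0, t].
Definition dom_g1 t : set R := `[1 - t, 1].

Definition overlap t : set R := `[1 - t, t].

Definition G t x : set R :=
  [set z | dom_g0 t x /\ z = g0 t x] `|` [set z | dom_g1 t x /\ z = g1 t x].

Definition Gq t (q : nat) y : set R :=
  iter q (fun A => \bigcup_(x in A) G t x) [set y].

Definition no_return t y : Prop :=
  forall q : nat, (1 <= q)%N -> Gq t q y `&` overlap t = set0.

(* A Borel probability measure on [0, 1] is a Borel probability measure on R
   which gives mass 1 to [0, 1]. *)
Definition bernoulli_convolution t
    (nu : probability (measurableTypeR R) R) : Prop :=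
  nu `[0, 1]%classic = 1%E /\
  forall A : set (measurableTypeR R), measurable A -> A `<=` `[0, 1] ->
    nu A = ((2^-1)%:E * nu (g0 t @` (A `&` dom_g0 t))
          + (2^-1)%:E * nu (g1 t @` (A `&` dom_g1 t)))%E.

Definition has_local_dimension (nu : probability (measurableTypeR R) R)
    (y d : R) : Prop :=
  ln (fine (nu `[y - r, y + r]%classic)) / ln r @[r --> 0^'+] --> d.

Definition has_density (nu : probability (measurableTypeR R) R)
    (y d : R) : Prop :=
  fine (nu `[y - e, y + e]%classic) / (2 * e) @[e --> 0^'+] --> d.

End MultivaluedMap.

Definition two_address_crossing (R : realType) (b c : seq01) (t y : R) : Prop :=
  [/\ b 0%N = false /\ c 0%N = true,
      2^-1 < t <= t2 R,
      smallest_crossing b c t,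
      y = address_curve b t &
      no_return t y].

Definition nonperiodic_kneading (R : realType) (b : seq01) : Prop :=
  kneading R b /\ ~ purely_periodic b.

(* 0111... and 1000..., whose binary number is 1/2, are not itineraries, but
   they are always addresses of the end points t and 1 - t of the overlap. *)
Definition half_low : seq01 := fun k => (0 < k)%N.
Definition half_high : seq01 := fun k => k == 0%N.

(* Main.v *)
(* Write X_s(t) for the address curve of s, so that X_s(t) = (1 - t) s_1 + t X_s'(t)
   where s' is the shifted sequence.

   Uniqueness: off the overlap the next digit is forced, so y has exactly one
   address for each choice of the first digit.

   Local dimension: after n steps a ball of radius of order t^n around y has
   turned into two balls around orbit points, and whenever an orbit ball touches
   the overlap it also spawns a ball around 0 or 1, whose mass just halves from
   then on.  Hence the mass is at most of order n 2^-n.  Around every point of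
   [0, 1] the mass of the ball of radius t^n is at least 2^-n.  The density
   vanishes because ln 2 / ln (1/t) > 1.

   Converse: the kneading property holds because, off the overlap, the order of
   the points is the lexicographic order of their addresses.  If the two curves
   met at some s < t, then the map sending X_u(t) to X_u(s), for u in the
   itineraries of the piecewise linear map with break point y, would be Hoelder
   with exponent ln s / ln t > 1, hence constant, although it fixes 0 and 1. *)
Require Import Defs.
From mathcomp Require Import ring lra.

Set Implicit Arguments.
Unset Strict Implicit.
Unset Printing Implicit Defensive.

Local Open Scope classical_set_scope.
Local Open Scope ring_scope.

(** * Address curves *)

Section AddressCurve.
Variable R : realType.
Implicit Types (b u v s : seq01) (t x y z : R).

Lemma shift0 b : shift 0 b = b.
Proof. by []. Qed.

Lemma shift_shift j k b : shift j (shift k b) = shift (k + j) b.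
Proof. by apply/funext => n; rewrite /shift addnA. Qed.

Lemma expr_lt_eventually (q e : R) : 0 < q < 1 -> 0 < e -> exists n, q ^+ n < e.
Proof.
move=> /andP[q0 q1] e0.
have /cvgr_lt : (fun n => q ^+ n) @ \oo --> (0 : R) by apply: cvg_expr; rewrite gtr0_norm.
by move=> /(_ _ e0)[n _ /(_ n (leqnn n))] ?; exists n.
Qed.

Lemma eq0_le_geometric (q x M : R) : 0 < q < 1 ->
  (forall n, `|x| <= M * q ^+ n) -> x = 0.
Proof.
move=> q01 xM; apply/eqP/negP => /negP x0.
have x0' : 0 < `|x| by rewrite normr_gt0.
have M0 : 0 < M by have := xM 0%N; rewrite expr0 mulr1; exact: lt_le_trans.
have [n] := expr_lt_eventually q01 (divr_gt0 x0' M0).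
by rewrite ltr_pdivlMr // mulrC ltNge xM.
Qed.

(** Iterating gives [e 0 = q ^+ n * e n], which tends to 0 as [e] is bounded; solutions of the same
    digit recursion are identified in this way. *)
Lemma geometric_fixed_eq0 (q M : R) (e : nat -> R) : 0 < q < 1 ->
  (forall n, e n = q * e n.+1) -> (forall n, `|e n| <= M) -> e 0%N = 0.
Proof.
move=> q01 eS eM; apply: (@eq0_le_geometric q _ M) => // n.
have -> : e 0%N = q ^+ n * e n.
  by elim: n => [|n IH]; rewrite ?expr0 ?mul1r // IH eS mulrA exprSr.
have /andP[q0 _] := q01.
by rewrite normrM gtr0_norm ?exprn_gt0 // mulrC ler_wpM2r ?exprn_ge0 // ltW.
Qed.

Lemma is_cvg_address_series t b : 0 < t < 1 ->
  cvgn (series (fun k => (b k)%:R * t ^+ k.+1 : R)).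
Proof.
move=> /andP[t0 t1].
apply: (@series_le_cvg _ _ (geometric t t)) => [n|n|n|].
- by rewrite mulr_ge0 // exprn_ge0 // ltW.
- by rewrite /= mulr_ge0 ?exprn_ge0 ?ltW.
- by rewrite /= -exprS ler_piMl ?lern1 ?leq_b1 // exprn_ge0 // ltW.
- by apply: is_cvg_geometric_series; rewrite gtr0_norm.
Qed.

Lemma address_curveS t b : 0 < t < 1 ->
  address_curve b t = (1 - t) * (b 0%N)%:R + t * address_curve (shift 1 b) t.
Proof.
move=> t01; have /andP[t0 t1] := t01.
pose u b : R^nat := fun k => (b k)%:R * t ^+ k.+1.
have uS : (fun n => series (u b) (n + 1)%N) =
    (fun n => (b 0%N)%:R * t + t * series (u (shift 1 b)) n).
  apply/funext => n /=; rewrite addn1 /series /= big_nat_recl // /u expr1; congr (_ + _).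
  by rewrite mulr_sumr; apply: eq_bigr => i _; rewrite [RHS]mulrCA -exprS.
have lS : limn (series (u b)) = (b 0%N)%:R * t + t * limn (series (u (shift 1 b))).
  apply/cvg_lim => //; rewrite -(cvg_shiftn 1) uS.
  apply: cvgD; first by apply: cvg_cst.
  by apply: cvgM; [apply: cvg_cst | exact: is_cvg_address_series].
rewrite /address_curve -!/(u _) lS.
have t_neq0 : t != 0 by rewrite gt_eqF.
by field.
Qed.

Lemma address_curve_shiftS t b n : 0 < t < 1 ->
  address_curve (shift n b) t =
  (1 - t) * (b n)%:R + t * address_curve (shift n.+1 b) t.
Proof. by move=> t01; rewrite address_curveS // shift_shift addn1 /shift addn0. Qed.

Lemma address_curve_ge0 t b : 0 < t < 1 -> 0 <= address_curve b t.
Proof.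
move=> t01; have /andP[t0 t1] := t01.
apply: mulr_ge0; first by rewrite divr_ge0 ?subr_ge0 // ltW.
apply: limr_ge; first exact: is_cvg_address_series.
by near=> n; apply: sumr_ge0 => i _; rewrite mulr_ge0 // exprn_ge0 // ltW.
Unshelve. all: end_near. Qed.

(** Flipping all digits realises the symmetry x -> 1 - x, which reduces statements about first digit
    1 to first digit 0. *)
Definition compl01 b : seq01 := fun n => ~~ b n.

Lemma compl01K : involutive compl01.
Proof. by move=> b; apply/funext => n; rewrite /compl01 negbK. Qed.

Lemma shift_compl01 k b : shift k (compl01 b) = compl01 (shift k b).
Proof. by []. Qed.

(** Any bound uniform in [b] suffices to prove the symmetry below, from which the sharp bound 1 then
    follows. *)
Lemma address_curve_bounded t : 0 < t < 1 ->
  exists M, forall b, `|address_curve b t| <= M.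
Proof.
move=> t01; have /andP[t0 t1] := t01.
exists ((1 - t) / t * limn (series (geometric t t))) => b.
rewrite ger0_norm ?address_curve_ge0 // /address_curve.
apply: ler_wpM2l; first by rewrite divr_ge0 ?subr_ge0 // ltW.
apply: lim_series_le; first exact: is_cvg_address_series.
  by apply: is_cvg_geometric_series; rewrite gtr0_norm.
by move=> n; rewrite /= -exprS ler_piMl ?lern1 ?leq_b1 // exprn_ge0 // ltW.
Qed.

Lemma address_curve_compl t b : 0 < t < 1 ->
  address_curve (compl01 b) t = 1 - address_curve b t.
Proof.
move=> t01; have [M bM] := address_curve_bounded t01.
suff : address_curve (shift 0 (compl01 b)) t + address_curve (shift 0 b) t - 1 = 0.
  by rewrite !shift0; lra.
pose e n := address_curve (shift n (compl01 b)) t + address_curve (shift n b) t - 1.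
apply: (@geometric_fixed_eq0 t (M + M + 1) e) => // n; rewrite /e.
  rewrite !(address_curve_shiftS _ n) // {1}/compl01.
  by case: (b n) => /=; ring.
rewrite (le_trans (ler_normB _ _)) // normr1 lerD2r (le_trans (ler_normD _ _)) //.
by rewrite lerD.
Qed.

Lemma address_curve_le1 t b : 0 < t < 1 -> address_curve b t <= 1.
Proof.
move=> t01; have := address_curve_ge0 (compl01 b) t01.
by rewrite address_curve_compl //; lra.
Qed.

Lemma address_curve_norm1 t b : 0 < t < 1 -> `|address_curve b t| <= 1.
Proof. by move=> t01; rewrite ger0_norm ?address_curve_ge0 ?address_curve_le1. Qed.

Lemma address_curve_unique t b (x : nat -> R) (M : R) : 0 < t < 1 ->
  (forall n, `|x n| <= M) ->
  (forall n, x n = (1 - t) * (b n)%:R + t * x n.+1) ->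
  address_curve b t = x 0%N.
Proof.
move=> t01 xM xS.
suff : address_curve (shift 0 b) t - x 0%N = 0 by rewrite shift0; lra.
apply: (@geometric_fixed_eq0 t (1 + M) (fun n => address_curve (shift n b) t - x n)) => // n.
  by rewrite address_curve_shiftS // (xS n); ring.
by rewrite (le_trans (ler_normB _ _)) // lerD // address_curve_norm1.
Qed.

Lemma address_curve_false t : 0 < t < 1 -> address_curve (fun=> false) t = 0.
Proof.
move=> t01; apply: (@address_curve_unique t _ (fun=> 0) 0) => // n.
  by rewrite normr0.
by rewrite !mulr0 addr0.
Qed.

(** At t = 1/2 the factor (1 - t) / t is 1, so facts on address curves cover binary numbers too. *)
Lemma binaryE b : binary R b = address_curve b 2^-1.
Proof. by rewrite /address_curve /binary; set l := limn _; lra. Qed.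

Lemma half01 : 0 < (2^-1 : R) < 1.
Proof. by apply/andP; split; lra. Qed.

End AddressCurve.

(** * Orbits that avoid the overlap *)

Section Dynamics.
Variable R : realType.
Implicit Types (b c u v w s : seq01) (t x y z : R).

Lemma overlapE t x : overlap t x <-> 1 - t <= x <= t.
Proof. by rewrite /overlap /= in_itv. Qed.

Lemma overlap_compl t x : overlap t (1 - x) <-> overlap t x.
Proof. by rewrite !overlapE; split=> /andP[? ?]; apply/andP; split; lra. Qed.

(** The index [k.+1] exempts the starting point, which may lie in the overlap. *)
Definition off_overlap t u :=
  forall k, ~ overlap t (address_curve (shift k.+1 u) t).

Lemma off_overlap_compl t u : 0 < t < 1 -> off_overlap t u ->
  off_overlap t (compl01 u).
Proof.
by move=> t01 uD k; rewrite shift_compl01 address_curve_compl // overlap_compl.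
Qed.

Lemma address_curve_digit0 t u n : 0 < t < 1 -> u n = false ->
  address_curve (shift n u) t = t * address_curve (shift n.+1 u) t.
Proof. by move=> t01 un; rewrite address_curve_shiftS // un mulr0 add0r. Qed.

Lemma address_curve_digit1 t u n : 0 < t < 1 -> u n = true ->
  address_curve (shift n u) t = 1 - t + t * address_curve (shift n.+1 u) t.
Proof. by move=> t01 un; rewrite address_curve_shiftS // un mulr1. Qed.

Lemma address_curve_branch t u n : 0 < t < 1 ->
  if u n then 1 - t <= address_curve (shift n u) t
  else address_curve (shift n u) t <= t.
Proof.
move=> t01; have /andP[t0 t1] := t01.
have X0 := address_curve_ge0 (shift n.+1 u) t01.
have X1 := address_curve_le1 (shift n.+1 u) t01.
case un: (u n); first by rewrite address_curve_digit1 //; nra.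
by rewrite address_curve_digit0 //; nra.
Qed.

Lemma off_overlap_digit t u n : 0 < t < 1 ->
  ~ overlap t (address_curve (shift n u) t) ->
  if u n then t < address_curve (shift n u) t
  else address_curve (shift n u) t < 1 - t.
Proof.
move=> t01; rewrite overlapE => /negP; rewrite negb_and -!ltNge => H.
have := address_curve_branch u n t01.
by case: (u n) => H'; case/orP: H => // H; lra.
Qed.

Lemma address_curve_prefix t u v n : 0 < t < 1 ->
  (forall i, (i < n)%N -> u i = v i) ->
  address_curve u t - address_curve v t =
  t ^+ n * (address_curve (shift n u) t - address_curve (shift n v) t).
Proof.
move=> t01; elim: n => [|n IH] uv; first by rewrite expr0 mul1r !shift0.
rewrite IH => [|i ilt]; last by apply: uv; rewrite ltnS ltnW.
by rewrite !(address_curve_shiftS _ n) // uv // exprSr; ring.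
Qed.

Definition cons01 (d : bool) u : seq01 := fun n => if n is m.+1 then u m else d.

Lemma shift_cons01 d u : shift 1 (cons01 d u) = u.
Proof. by []. Qed.

Lemma address_curve_cons t d u : 0 < t < 1 ->
  address_curve (cons01 d u) t = (1 - t) * d%:R + t * address_curve u t.
Proof. by move=> t01; rewrite address_curveS // shift_cons01. Qed.

(** These are the itineraries of the piecewise linear map with break point [y]; at [y] itself both
    digits are allowed. *)
Definition admissible t y u := forall k,
  if u k then y <= address_curve (shift k u) t
  else address_curve (shift k u) t <= y.

Lemma admissible_compl t y u : 0 < t < 1 -> admissible t y u ->
  admissible t (1 - y) (compl01 u).
Proof.
move=> t01 uy k; rewrite shift_compl01 address_curve_compl // /compl01.
by have := uy k; case: (u k) => /= ?; lra.
Qed.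

(** The digits are read off the orbit of [x] under the map that switches branch at [y]; it stays in
    [0, 1] because [y] lies in the overlap. *)
Lemma exists_admissible t y x : 0 < t < 1 -> overlap t y -> 0 <= x <= 1 ->
  exists u, address_curve u t = x /\ admissible t y u.
Proof.
move=> t01 /overlapE/andP[y0 y1] x01; have /andP[t0 t1] := t01.
pose F z := if y < z then (z - (1 - t)) / t else z / t.
pose u : seq01 := fun k => y < iter k F x.
have F01 k : 0 <= iter k F x <= 1.
  elim: k => //= k /andP[z0 z1]; rewrite /F; case: ltP => yz; apply/andP; split.
  - by rewrite divr_ge0 //; lra.
  - by rewrite ler_pdivrMr //; lra.
  - by rewrite divr_ge0 //; lra.
  - by rewrite ler_pdivrMr //; lra.
have X k : address_curve (shift k u) t = iter k F x.
  rewrite -[in RHS](addn0 k).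
  apply: (@address_curve_unique _ t _ (fun n => iter (k + n) F x) 1) => // n.
    by have /andP[? ?] := F01 (k + n)%N; rewrite ger0_norm.
  rewrite addnS /shift /u /= {3}/F; have t_neq0 : t != 0 by rewrite gt_eqF.
  by case: ltP => _ /=; field.
exists u; split; first by have := X 0%N.
by move=> k; rewrite X /u; case: ltP => // /ltW.
Qed.

Lemma param01 t : 2^-1 < t < 1 -> 0 < t < 1.
Proof. by move=> /andP[? ?]; apply/andP; split; lra. Qed.

Lemma off_overlap_inj t u v : 2^-1 < t < 1 -> off_overlap t u ->
  address_curve u t = address_curve v t -> u 0%N = v 0%N -> u = v.
Proof.
move=> t12 uD Xuv uv0; have t01 := param01 t12; have /andP[t0 _] := t12.
suff H n : address_curve (shift n u) t = address_curve (shift n v) t /\ u n = v n.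
  by apply/funext => n; have [] := H n.
elim: n => [//|n [XE uvE]].
have XS : address_curve (shift n.+1 u) t = address_curve (shift n.+1 v) t.
  move: XE; rewrite !(address_curve_shiftS _ n) // uvE => /addrI /mulfI; apply.
  by rewrite gt_eqF //; lra.
split=> //.
have := off_overlap_digit t01 (uD n).
have := uD n; rewrite XS => /(off_overlap_digit t01).
by case: (u _); case: (v _) => // ? ?; lra.
Qed.

Lemma Gq_shift t q u : 0 < t < 1 ->
  Gq t q (address_curve u t) (address_curve (shift q u) t).
Proof.
move=> t01; elim: q => [//|q IH]; exists (address_curve (shift q u) t) => //.
have /andP[t0 t1] := t01.
have t_neq0 : t != 0 by rewrite gt_eqF.
have X0 := address_curve_ge0 (shift q u) t01.
have X1 := address_curve_le1 (shift q u) t01.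
have := address_curve_branch u q t01; case uq: (u q) => Xq.
- right; split; first by rewrite /dom_g1 /= in_itv /= Xq.
  by rewrite /g1 (address_curve_digit1 t01 uq); field.
- left; split; first by rewrite /dom_g0 /= in_itv /= X0.
  by rewrite /g0 (address_curve_digit0 t01 uq); field.
Qed.

Definition cat01 q w v : seq01 := fun n => if (n < q)%N then w n else v (n - q)%N.

Lemma shift_cat01 q w v : shift q (cat01 q w v) = v.
Proof. by apply/funext => n; rewrite /shift /cat01 ltnNge leq_addr addKn. Qed.

(** Recording the [q] branch choices from [y] to [z] yields the word [w]; only its first [q] digits
    matter. *)
Lemma Gq_prefix t q y z : 0 < t < 1 -> Gq t q y z ->
  exists w, forall v, address_curve v t = z -> address_curve (cat01 q w v) t = y.
Proof.
move=> t01; have /andP[t0 t1] := t01.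
have t_neq0 : t != 0 by rewrite gt_eqF.
elim: q z => [|q IH] z.
  move=> ->; exists (fun=> false) => v <-; congr address_curve.
  by apply/funext => n; rewrite /cat01 ltn0 subn0.
move=> [x /IH[w wx] Gxz].
have [d xE] : exists d : bool, x = (1 - t) * d%:R + t * z.
  by case: Gxz => [[_ ->]|[_ ->]]; [exists false; rewrite /g0 /= | exists true; rewrite /g1 /=]; field.
exists (fun n => if (n < q)%N then w n else d) => v vz.
rewrite -(wx (cons01 d v)) ?address_curve_cons ?vz //; congr address_curve.
apply/funext => n; rewrite /cat01 ltnS leq_eqVlt.
by case: ltngtP => //= [ltqn|->]; rewrite ?subnn // -(subnSK ltqn).
Qed.

Lemma no_returnP t y : 2^-1 < t < 1 -> 
  no_return t y <-> (forall u, address_curve u t = y -> off_overlap t u).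
Proof.
move=> t12; have t01 := param01 t12; have /andP[t0 t1] := t12.
split=> [yD u uy k uD|yD q q0].
  have : (Gq t k.+1 y `&` overlap t) (address_curve (shift k.+1 u) t).
    by split=> //; rewrite -uy; exact: Gq_shift.
  by rewrite yD.
rewrite -subset0 => z [/(Gq_prefix t01)[w wy] zD].
have [|v [vz _]] := @exists_admissible t z z t01 zD.
  by have /overlapE/andP[? ?] := zD; apply/andP; split; lra.
apply: (yD _ (wy _ vz) q.-1); rewrite prednK // shift_cat01 vz //.
Qed.

End Dynamics.

(** * Points with exactly two addresses, kneading sequences, and the bound [t2] *)

Section Crossing.
Variable R : realType.
Implicit Types (b c u v w : seq01) (s t x y z : R).

Lemma exactly_two_addresses_off_overlap t y b c : 2^-1 < t < 1 ->
  b 0%N = false -> c 0%N = true -> off_overlap t b -> off_overlap t c ->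
  address_curve b t = y -> address_curve c t = y -> exactly_two_addresses t y.
Proof.
move=> t12 b0 c0 bD cD bE cE; exists b, c; split=> [bc|]; first by rewrite bc c0 in b0.
apply/seteqP; split=> [u /= uE|u /= [->|->]]; rewrite /is_address //.
have [u0|u0] := boolP (u 0%N); [right|left].
  by apply/esym/(off_overlap_inj t12 cD); rewrite ?cE ?c0 ?u0.
by apply/esym/(off_overlap_inj t12 bD); rewrite ?bE ?b0 ?(negbTE u0).
Qed.

Lemma exists_address_digit t y (d : bool) : 2^-1 < t < 1 -> overlap t y ->
  exists u, address_curve u t = y /\ u 0%N = d.
Proof.
move=> t12 yD; have t01 := param01 t12; have /andP[t0 t1] := t01.
have /overlapE/andP[y0 y1] := yD.
have [|u [uE _]] := @exists_admissible _ t y ((y - (1 - t) * d%:R) / t) t01 yD.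
  by case: d => /=; apply/andP; split; rewrite ?divr_ge0 ?ler_pdivrMr //; lra.
exists (cons01 d u); split=> //; rewrite address_curve_cons // uE.
by field; rewrite gt_eqF.
Qed.

(** If the orbit met the overlap at [z], the two first digits possible at [z] would give two
    addresses of [y] with a common first digit; the other first digit possible at [y] gives a
    third. *)
Lemma exactly_two_addresses_inv t y : 2^-1 < t < 1 -> overlap t y ->
  exactly_two_addresses t y ->
  no_return t y /\
  exists b c, [/\ b 0%N = false, c 0%N = true,
                address_curve b t = y & address_curve c t = y].
Proof.
move=> t12 yD [s1 [s2 [_ sE]]]; have t01 := param01 t12.
have addr u : address_curve u t = y -> u = s1 \/ u = s2.
  by move=> uE; have : [set s | is_address t y s] u by []; rewrite sE.
split; last first.
  have [b [bE b0]] := exists_address_digit false t12 yD.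
  by have [c [cE c0]] := exists_address_digit true t12 yD; exists b, c.
move=> [//|q] _; rewrite -subset0 => z [].
move=> /(Gq_prefix t01)[w wz] zD.
have [v0 [v0E v00]] := exists_address_digit false t12 zD.
have [v1 [v1E v10]] := exists_address_digit true t12 zD.
have [u [uE u0]] := exists_address_digit (~~ w 0%N) t12 yD.
have neqv : cat01 q.+1 w v0 <> cat01 q.+1 w v1.
  by move/(congr1 (shift q.+1)); rewrite !shift_cat01 => v01; rewrite v01 v10 in v00.
have neqw v : u <> cat01 q.+1 w v.
  by move/(congr1 (@^~ 0%N)); rewrite u0 /cat01 /=; case: (w 0%N).
have [] := addr _ (wz _ v0E); have [] := addr _ (wz _ v1E); have [] := addr _ uE.
all: by move=> E1 E2 E3; (try by apply: (neqw v0); congruence);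
  (try by apply: (neqw v1); congruence); apply: neqv; congruence.
Qed.

Lemma address_curve_eq1 t v : 0 < t < 1 -> address_curve v t = 1 -> v = fun=> true.
Proof.
move=> t01; have /andP[t0 t1] := t01.
suff H n : address_curve v t = 1 -> address_curve (shift n v) t = 1 /\ v n = true.
  by move=> v1; apply/funext => n; have [] := H n v1.
have step m : address_curve (shift m v) t = 1 ->
    v m = true /\ address_curve (shift m.+1 v) t = 1.
  have X1 := address_curve_le1 (shift m.+1 v) t01.
  by rewrite address_curve_shiftS //; case: (v m) => /= H; split=> //; nra.
move=> v1; elim: n => [|n [/step[_ XS] _]]; first by have [] := step 0%N v1.
by split=> //; have [] := step _ XS.
Qed.

Lemma address_curve_eq_t t b : 0 < t < 1 -> b 0%N = false ->
  address_curve b t = t -> b = half_low.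
Proof.
move=> t01 b0; have /andP[t0 _] := t01; have t_neq0 : t != 0 by rewrite gt_eqF.
rewrite address_curveS // b0 mulr0 add0r -[RHS]mulr1 => /(mulfI t_neq0).
move=> /(address_curve_eq1 t01) b1; apply/funext => -[//|n].
by have := congr1 (@^~ n) b1.
Qed.

(* Off the overlap the digits are forced by the position, so the order of the
   points is the lexicographic order of their addresses. *)
Lemma binary_le_off_overlap t u v : 2^-1 < t < 1 ->
  off_overlap t u -> off_overlap t v -> u 0%N = v 0%N ->
  address_curve u t <= address_curve v t -> binary R u <= binary R v.
Proof.
move=> t12 uD vD uv0 uv; have t01 := param01 t12; have /andP[t0 t1] := t01.
have [neq_uv|] := pselect (exists n, u n != v n); last first.
  move=> /forallNP uvE; suff -> : u = v by [].
  by apply/funext => n; have /negP := uvE n; rewrite negbK => /eqP.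
have [[|n]] := ex_minnP neq_uv; first by rewrite uv0 eqxx.
move=> neq least.
have eq_lt i : (i < n.+1)%N -> u i = v i.
  by move=> ltin; apply/eqP; apply: contraTT ltin => /least; rewrite -leqNgt.
have Xt := address_curve_prefix t01 eq_lt.
have Xle : address_curve (shift n.+1 u) t <= address_curve (shift n.+1 v) t.
  by rewrite -subr_le0 -(pmulr_rle0 _ (exprn_gt0 n.+1 t0)) -Xt subr_le0.
rewrite -subr_le0 !binaryE (address_curve_prefix (half01 R) eq_lt).
rewrite pmulr_rle0 ?exprn_gt0 ?invr_gt0 // subr_le0.
(* At the first difference the point with digit 0 lies left of the overlap and the one with digit 1
   right of it, so [u] has the digit 0. The binary tails are then separated by 1/2. *)
have := off_overlap_digit t01 (uD n); have := off_overlap_digit t01 (vD n).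
have := address_curve_branch u n.+1 (half01 R).
have := address_curve_branch v n.+1 (half01 R).
have half : 1 - 2^-1 = 2^-1 :> R by lra.
rewrite half.
by move: neq; case: (u _); case: (v _) => // _ *; lra.
Qed.

Lemma binary_compl k b : binary R (shift k (compl01 b)) = 1 - binary R (shift k b).
Proof. by rewrite !binaryE shift_compl01 address_curve_compl ?half01. Qed.

Lemma itineraryP b : itinerary R b <->
  exists2 e : R, 0 < e & forall k, e <= `|binary R (shift k b) - 2^-1|.
Proof.
split=> [it|[e e0 far]].
  apply: contrapT => /forall2NP no_e; apply: it => N /nbhs_ballP[e /= e0 eN].
  case: (no_e e) => // /existsNP[k /negP]; rewrite -ltNge distrC => ltk.
  by exists (binary R (shift k b)); split; [exists k | exact: eN].
move=> /(_ _ (nbhsx_ballx _ _ e0)) [_ [[k _ <-]]].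
by rewrite /ball /= distrC ltNge far.
Qed.

(** Later orbit points with digit 0 lie below 1 - t, hence below [y]; those with digit 1 exceed t
    and are reflected below 1 - t. By monotonicity their binary numbers are at least as far from 1/2
    as that of [b]. *)
Lemma kneading_off_overlap t b : 2^-1 < t < 1 -> b 0%N = false ->
  overlap t (address_curve b t) -> address_curve b t < t ->
  off_overlap t b -> nonperiodic_kneading R b.
Proof.
move=> t12 b0 yD ylt bD; have t01 := param01 t12; have /andP[t0 t1] := t01.
have /overlapE/andP[y0 _] := yD.
have per : ~ purely_periodic b.
  move=> [[|p] [p0 bp]] //; apply: (bD p).
  by rewrite (_ : shift p.+1 b = b) //; apply/funext.
have b_lt : binary R b < 2^-1.
  rewrite binaryE lt_neqAle; apply/andP; split; last first.
    by have := address_curve_branch b 0 (half01 R); rewrite b0.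
  (* Binary number 1/2 and first digit 0 force [half_low], whose curve takes the value t, against
     [ylt]. *)
  apply/eqP => /(address_curve_eq_t (half01 R) b0) bE.
  move: ylt; rewrite address_curveS // b0 mulr0 (_ : shift 1 b = compl01 (fun=> false)).
    by rewrite address_curve_compl // address_curve_false //; lra.
  by rewrite bE.
have b_far k : 2^-1 - binary R b <= `|binary R (shift k b) - 2^-1|.
  case: k => [|k]; first by rewrite shift0 distrC ler_normr lexx.
  have bkD : off_overlap t (shift k.+1 b) by move=> j; rewrite shift_shift addSn.
  have sb0 : shift k.+1 b 0%N = b k.+1 by rewrite /shift addn0.
  have := off_overlap_digit t01 (bD k); rewrite ler_normr.
  case bk : (b k.+1) => Xbk; apply/orP; [left|right].
    have cb0 : compl01 (shift k.+1 b) 0%N = b 0%N by rewrite /compl01 sb0 bk b0.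
    have := binary_le_off_overlap t12 (off_overlap_compl t01 bkD) bD cb0.
    rewrite address_curve_compl // -shift_compl01 binary_compl => H.
    by have := H _; lra.
  have sbb : shift k.+1 b 0%N = b 0%N by rewrite sb0 bk b0.
  by have := binary_le_off_overlap t12 bkD bD sbb; lra.
split=> //; split.
- by apply/itineraryP; exists (2^-1 - binary R b) => //; lra.
- move=> [d bd]; apply: per; exists 1%N; split=> // k; by rewrite !bd.
- by move=> k; apply/negP; rewrite -leNgt [leLHS]distrC ger0_norm ?b_far //; lra.
Qed.

Lemma kneading_compl b : nonperiodic_kneading R (compl01 b) -> nonperiodic_kneading R b.
Proof.
have dist k : `|binary R (shift k (compl01 b)) - 2^-1| = `|binary R (shift k b) - 2^-1|.
  by rewrite binary_compl distrC; congr (`|_|); lra.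
move=> [[it cst far] per]; split; first split.
- move/itineraryP: it => [e e0 eb]; apply/itineraryP; exists e => // k.
  by rewrite -dist.
- by move=> [d bd]; apply: cst; exists (~~ d) => k; rewrite /compl01 bd.
- by move=> k; rewrite -dist -[X in _ < X](dist 0%N); exact: far.
- by move=> [p [p0 bp]]; apply: per; exists p; split=> // k; rewrite /compl01 bp.
Qed.

(** [t2] is the positive root of t^2 + t = 1; the claim amounts to (2 t + 1)^2 <= 5. *)
Lemma le_t2 t : 0 < t < 1 -> t ^+ 2 + t <= 1 -> t <= t2 R.
Proof.
move=> /andP[t0 t1] H; rewrite /t2 ler_pdivlMr // lerBrDr.
rewrite -[leLHS]ger0_norm -?sqrtr_sqr; last lra.
by rewrite ler_wsqrtr // expr2; nra.
Qed.

(* Below 1 - t the map g0 cannot jump over the overlap if (1 - t) / t < t. *)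
Lemma off_overlap_eq0 t u : 2^-1 < t < 1 -> 1 < t ^+ 2 + t ->
  off_overlap t u -> address_curve u t < 1 - t -> address_curve u t = 0.
Proof.
move=> t12 tt uD u0; have t01 := param01 t12; have /andP[t0 t1] := t12.
have small n : address_curve (shift n u) t < 1 - t.
  elim: n => [//|n IH]; have := address_curve_branch u n t01.
  have := off_overlap_digit t01 (uD n); case: (u n.+1) => //.
  case un : (u n); first by move=> _ ?; lra.
  move: IH; rewrite (address_curve_digit0 t01 un) => IH Xlt _; move: tt; rewrite expr2 => tt.
  by nra.
have digit0 n : u n = false.
  have := address_curve_branch u n t01; have := small n.
  by case: (u n) => // *; lra.
by rewrite (_ : u = fun=> false) ?address_curve_false //; apply/funext.
Qed.

(** If t^2 + t > 1, both images of [y] can only be 0 or 1, so [y] lies in {0, t} and in {1 - t, 1},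
    which is impossible for 1/2 < t < 1. *)
Lemma crossing_le_t2 t b c : 2^-1 < t < 1 -> b 0%N = false -> c 0%N = true ->
  off_overlap t b -> off_overlap t c -> address_curve b t = address_curve c t ->
  t <= t2 R.
Proof.
move=> t12 b0 c0 bD cD bc; have t01 := param01 t12; have /andP[t0 t1] := t01.
apply: le_t2 => //; rewrite leNgt; apply/negP => tt.
have ends u : off_overlap t u -> ~ overlap t (address_curve u t) ->
    address_curve u t = 0 \/ address_curve u t = 1.
  move=> uD; have := off_overlap_eq0 t12 tt uD.
  have := off_overlap_eq0 t12 tt (off_overlap_compl t01 uD).
  rewrite address_curve_compl // overlapE => H1 H0 /negP.
  rewrite negb_and -!ltNge => /orP[/H0|H]; [by left|right].
  by have := H1 _; lra.
have tailD k v : off_overlap t v -> off_overlap t (shift k v).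
  by move=> vD j; rewrite shift_shift addnS; exact: vD.
move: bc; rewrite address_curveS // (address_curveS c) // b0 c0 mulr0 mulr1 add0r.
have /andP[t12' _] := t12.
by have [||->|->] := ends (shift 1 b); [exact: tailD|exact: bD| |];
  (have [||->|->] := ends (shift 1 c); [exact: tailD|exact: cD| |]); nra.
Qed.

End Crossing.

(** * The first crossing *)

Section Uncrossed.
Variable R : realType.
Implicit Types (b c u v w : seq01) (s t x y z : R).

(** After a nonempty common prefix shorter than [n] the two points differ by less than [d]. A digit
    1 in [b] alone would separate them by [d] across [y]; a digit 1 in [u] alone would put the point
    of [b] at or right of [y], while its digit 0 puts it left of 1 - t. *)
Lemma admissible_agree_left t y b u (d : R) n : 0 < t < 1 -> overlap t y ->
  admissible t y u -> u 0%N = false -> b 0%N = false ->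
  off_overlap t b -> address_curve b t = y ->
  (forall k, b k.+1 -> y + d <= address_curve (shift k.+1 b) t) -> 0 < d ->
  y - address_curve u t <= d * t ^+ n ->
  forall i, (i < n)%N -> u i = b i.
Proof.
move=> t01 /overlapE/andP[y0 _] uy u0 b0 bD bE far d0 uyn.
have /andP[t0 t1] := t01.
suff H j : (j <= n)%N -> forall i, (i < j)%N -> u i = b i by exact: H.
elim: j => [//|j IH] ltjn i; rewrite ltnS leq_eqVlt => /orP[/eqP ->{i}|]; last first.
  by apply: IH; rewrite ltnW.
case: j IH ltjn => [|j] IH ltjn; first by rewrite u0 b0.
have Xbu := address_curve_prefix t01 (IH (ltnW ltjn)).
have tj0 := exprn_gt0 j.+1 t0.
have Xle : address_curve (shift j.+1 u) t <= address_curve (shift j.+1 b) t.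
  rewrite -subr_le0 -(pmulr_rle0 _ tj0) -Xbu bE subr_le0.
  by have := uy 0%N; rewrite u0.
have Xlt : address_curve (shift j.+1 b) t - address_curve (shift j.+1 u) t < d.
  have : t ^+ j.+1 * (address_curve (shift j.+1 b) t - address_curve (shift j.+1 u) t)
     <= d * t ^+ n.
    by rewrite -opprB mulrN -Xbu bE opprB.
  rewrite -(subnKC (ltnW ltjn)) exprD mulrCA ler_pM2l // => /le_lt_trans; apply.
  rewrite gtr_pMr // exprn_ilt1 ?ltW //.
  by rewrite -lt0n subn_gt0.
have := off_overlap_digit t01 (bD j); have := uy j.+1; have := far j.
by case: (b _) => [/(_ isT)|_]; case: (u _) => // *; lra.
Qed.

Lemma admissible_close_left s t y b u (d : R) n : 0 < s < 1 -> 0 < t < 1 ->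
  overlap t y -> admissible t y u -> u 0%N = false -> b 0%N = false ->
  off_overlap t b -> address_curve b t = y ->
  (forall k, b k.+1 -> y + d <= address_curve (shift k.+1 b) t) -> 0 < d ->
  y - address_curve u t <= d * t ^+ n ->
  `|address_curve u s - address_curve b s| <= s ^+ n.
Proof.
move=> s01 t01 yD uy u0 b0 bD bE far d0 uyn.
have eq_lt := admissible_agree_left t01 yD uy u0 b0 bD bE far d0 uyn.
have /andP[s0 s1] := s01.
rewrite (address_curve_prefix s01 eq_lt) normrM gtr0_norm ?exprn_gt0 //.
rewrite ler_piMr ?exprn_ge0 ?(ltW s0) // ler_norml.
have := address_curve_ge0 (shift n u) s01; have := address_curve_ge0 (shift n b) s01.
have := address_curve_le1 (shift n u) s01; have := address_curve_le1 (shift n b) s01.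
by move=> *; apply/andP; split; lra.
Qed.

Lemma admissible_close_right s t y c u (d : R) n : 0 < s < 1 -> 0 < t < 1 ->
  overlap t y -> admissible t y u -> u 0%N = true -> c 0%N = true ->
  off_overlap t c -> address_curve c t = y ->
  (forall k, ~~ c k.+1 -> address_curve (shift k.+1 c) t <= y - d) -> 0 < d ->
  address_curve u t - y <= d * t ^+ n ->
  `|address_curve u s - address_curve c s| <= s ^+ n.
Proof.
move=> s01 t01 yD uy u0 c0 cD cE far d0 uyn.
have -> : address_curve u s - address_curve c s =
    address_curve (compl01 c) s - address_curve (compl01 u) s.
  by rewrite !address_curve_compl //; lra.
rewrite distrC.
apply: (@admissible_close_left s t (1 - y) _ _ d) => //.
- by apply/overlap_compl.
- exact: admissible_compl.
- by rewrite /compl01 u0.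
- by rewrite /compl01 c0.
- exact: off_overlap_compl.
- by rewrite address_curve_compl // cE.
- by move=> k /far; rewrite shift_compl01 address_curve_compl //; lra.
- by rewrite address_curve_compl //; lra.
Qed.

(* If the two curves also met at s < t, conjugating the parameter t to the
   parameter s would be a Hoelder map of exponent ln s / ln t > 1. *)
Lemma admissible_hoelder s t y b c (d : R) u v n : 0 < s < 1 -> 0 < t < 1 ->
  overlap t y -> b 0%N = false -> c 0%N = true ->
  off_overlap t b -> off_overlap t c ->
  address_curve b t = y -> address_curve c t = y -> 0 < d ->
  (forall k, b k.+1 -> y + d <= address_curve (shift k.+1 b) t) ->
  (forall k, ~~ c k.+1 -> address_curve (shift k.+1 c) t <= y - d) ->
  address_curve b s = address_curve c s ->
  admissible t y u -> admissible t y v ->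
  `|address_curve u t - address_curve v t| <= d * t ^+ n ->
  `|address_curve u s - address_curve v s| <= 2 * s ^+ n.
Proof.
move=> s01 t01 yD b0 c0 bD cD bE cE d0 farb farc bc.
have /andP[s0 s1] := s01; have /andP[t0 t1] := t01.
(* For opposite first digits [y] separates the points, so each is near [y] at t, and at [s] near the
   curve of [b] or [c]; these two meet at [s]. *)
have split01 u' v' m : admissible t y u' -> admissible t y v' ->
    u' 0%N = false -> v' 0%N = true ->
    `|address_curve u' t - address_curve v' t| <= d * t ^+ m ->
    `|address_curve u' s - address_curve v' s| <= 2 * s ^+ m.
  move=> uy vy u0 v0; have := uy 0%N; have := vy 0%N; rewrite u0 v0 !shift0 => yv yu.
  rewrite ler_norml => /andP[uvm _].
  have Hu : `|address_curve u' s - address_curve b s| <= s ^+ m.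
    by apply: (admissible_close_left s01 t01 yD uy u0 b0 bD bE farb d0); lra.
  have Hv : `|address_curve v' s - address_curve c s| <= s ^+ m.
    by apply: (admissible_close_right s01 t01 yD vy v0 c0 cD cE farc d0); lra.
  apply: (le_trans (ler_distD (address_curve b s) _ _)).
  by rewrite {2}bc [X in _ + X]distrC mulr2n mulrDl mul1r lerD.
elim: n u v => [|n IH] u v uy vy.
  move=> _; rewrite expr0 mulr1.
  by rewrite (le_trans (ler_normB _ _)) // mulr2n lerD ?address_curve_norm1.
have tailP w : admissible t y w -> admissible t y (shift 1 w).
  by move=> wy k; rewrite shift_shift; exact: wy.
(* For equal first digits a factor t, respectively s, cancels and the tails are compared one scale
   coarser. *)
have [uv0|] := eqVneq (u 0%N) (v 0%N).
  have eq_lt i : (i < 1)%N -> u i = v i by case: i.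
  rewrite !(address_curve_prefix _ eq_lt) // !expr1 !normrM (gtr0_norm t0) (gtr0_norm s0).
  rewrite !exprS [d * _]mulrCA [2 * _]mulrCA !ler_pM2l //.
  by apply: IH; exact: tailP.
case u0 : (u 0%N); case v0 : (v 0%N) => // _; last exact: split01.
by rewrite distrC => H; rewrite distrC; exact: split01.
Qed.

(** For y < t, later points with digit 1 lie beyond t, with gap t - y. For y = t the sequence is
    0111..., whose later points are all 1, with gap 1 - t. *)
Lemma far_right_of_crossing t y b : 2^-1 < t < 1 -> b 0%N = false -> off_overlap t b ->
  address_curve b t = y -> exists2 d : R, 0 < d &
  forall k, b k.+1 -> y + d <= address_curve (shift k.+1 b) t.
Proof.
move=> t12 b0 bD bE; have t01 := param01 t12; have /andP[t0 t1] := t01.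
have [ylt|yge] := ltP y t.
  exists (t - y); first by rewrite subr_gt0.
  move=> k bk; have := off_overlap_digit t01 (bD k); rewrite bk.
  by lra.
exists (1 - t) => [|k _]; first by rewrite subr_gt0.
have yt : y = t.
  by apply/eqP; rewrite eq_le yge -bE; have := address_curve_branch b 0 t01; rewrite b0 => ->.
have -> : shift k.+1 b = compl01 (fun=> false).
  by rewrite (address_curve_eq_t t01 b0) ?bE.
rewrite address_curve_compl // address_curve_false //; lra.
Qed.

Lemma far_left_of_crossing t y c : 2^-1 < t < 1 -> c 0%N = true -> off_overlap t c ->
  address_curve c t = y -> exists2 d : R, 0 < d &
  forall k, ~~ c k.+1 -> address_curve (shift k.+1 c) t <= y - d.
Proof.
move=> t12 c0 cD cE; have t01 := param01 t12.
have [||d d0 far] := @far_right_of_crossing t (1 - y) (compl01 c) t12 _ (off_overlap_compl t01 cD).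
- by rewrite /compl01 c0.
- by rewrite address_curve_compl // cE.
exists d => // k /far; rewrite shift_compl01 address_curve_compl //; lra.
Qed.

(** Going from 0 to 1 at parameter t in about 1 / (d t^n) equal steps moves the corresponding point
    at [s] by at most 2 s^n per step, so 1 is bounded by a multiple of (s / t)^n. *)
Lemma no_earlier_crossing s t y b c : 2^-1 < t < 1 -> 0 < s < t ->
  overlap t y -> b 0%N = false -> c 0%N = true ->
  off_overlap t b -> off_overlap t c ->
  address_curve b t = y -> address_curve c t = y ->
  address_curve b s <> address_curve c s.
Proof.
move=> t12 /andP[s0 st] yD b0 c0 bD cD bE cE bc.
have t01 := param01 t12; have /andP[t0 t1] := t01.
have s01 : 0 < s < 1 by rewrite s0 (lt_trans st).
have [d1 d10 farb] := far_right_of_crossing t12 b0 bD bE.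
have [d2 d20 farc] := far_left_of_crossing t12 c0 cD cE.
have [d [d0 dd1 dd2]] : exists d : R, [/\ 0 < d, d <= d1 & d <= d2].
  by exists (Num.min d1 d2); rewrite lt_min d10 d20 !ge_min !lexx orbT.
have holder n u v : admissible t y u -> admissible t y v ->
    `|address_curve u t - address_curve v t| <= d * t ^+ n ->
    `|address_curve u s - address_curve v s| <= 2 * s ^+ n.
  apply: (admissible_hoelder s01 t01 yD b0 c0 bD cD bE cE d0) => //.
    by move=> k /farb; lra.
  by move=> k /farc; lra.
have q01 : 0 < s / t < 1 by rewrite divr_gt0 //= ltr_pdivrMr ?mul1r.
suff : (1 : R) = 0 by apply/eqP; exact: oner_neq0.
apply: (@eq0_le_geometric _ (s / t) _ (2 / d + 2) q01) => n; rewrite normr1.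
have e0 : 0 < d * t ^+ n by rewrite mulr_gt0 ?exprn_gt0.
(* [N] exceeds 1 / (d t^n) by at most 1, so steps of length 1 / N fall under the Hoelder
   estimate. *)
pose N := (Num.truncn (d * t ^+ n)^-1).+1.
have N0 : 0 < N%:R :> R by rewrite ltr0n.
have eN : N%:R^-1 <= d * t ^+ n.
  by rewrite -[leRHS]invrK lef_pV2 ?posrE ?invr_gt0 //; apply/ltW/truncnS_gt.
have NE : N%:R <= (d * t ^+ n)^-1 + 1.
  by rewrite /N -natr1 lerD2r truncn_le // invr_ge0 ltW.
have chain i : (i <= N)%N -> forall u, admissible t y u ->
    address_curve u t = i%:R / N%:R -> address_curve u s <= i%:R * (2 * s ^+ n).
  elim: i => [_ u uy uE|i IH ltiN u uy uE].
    have cu1 : address_curve (compl01 u) t = 1 by rewrite address_curve_compl // uE; lra.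
    rewrite mul0r -[u]compl01K (address_curve_eq1 t01 cu1).
    by rewrite (_ : compl01 _ = fun=> false) ?address_curve_false.
  have iN01 : 0 <= (i%:R / N%:R : R) <= 1.
    by rewrite divr_ge0 //= ler_pdivrMr // mul1r ler_nat ltnW.
  have [v [vE vy]] := @exists_admissible _ t y _ t01 yD iN01.
  have := holder n u v uy vy; rewrite uE vE -mulrBl -natr1 addrAC subrr add0r mul1r.
  rewrite ger0_norm ?invr_ge0 ?(ltW N0) // => /(_ eN); rewrite ler_norml => /andP[_ H].
  by have := IH (ltnW ltiN) v vy vE; lra.
have [|u [uE uy]] := @exists_admissible _ t y 1 t01 yD; first by rewrite ler01 lexx.
have := chain N (leqnn N) u uy; rewrite divff ?gt_eqF // => /(_ uE).
have -> : address_curve u s = 1.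
  rewrite (address_curve_eq1 t01 uE) (_ : (fun=> true) = compl01 (fun=> false)) //.
  by rewrite address_curve_compl // address_curve_false // subr0.
move=> /le_trans; apply.
apply: (@le_trans _ _ (((d * t ^+ n)^-1 + 1) * (2 * s ^+ n))).
  by rewrite ler_pM2r // mulr_gt0 ?exprn_gt0.
have sn0 := exprn_gt0 n s0; have tn0 := exprn_gt0 n t0.
have -> : ((d * t ^+ n)^-1 + 1) * (2 * s ^+ n) = 2 / d * (s / t) ^+ n + 2 * s ^+ n.
  by rewrite expr_div_n; field; rewrite !gt_eqF.
rewrite [leRHS]mulrDl lerD2l ler_pM2l // expr_div_n ler_pdivlMr // ler_piMr ?(ltW sn0) //.
by rewrite exprn_ile1 ?ltW.
Qed.

End Uncrossed.

(** * Masses of balls *)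

Section BallMass.
Variables (R : realType) (t : R) (nu : probability (measurableTypeR R) R).
Hypotheses (t12 : 2^-1 < t < 1) (nuB : bernoulli_convolution t nu).
Implicit Types (x y z r : R) (u : seq01).

Let t01 : 0 < t < 1 := param01 t12.

Definition ball_mass x r : R := fine (nu `[x - r, x + r]%classic).

Lemma ball_massE x r : nu `[x - r, x + r]%classic = (ball_mass x r)%:E.
Proof. by rewrite /ball_mass fineK // fin_num_measure. Qed.

Lemma ball_mass_ge0 x r : 0 <= ball_mass x r.
Proof. by rewrite fine_ge0. Qed.

Lemma ball_mass_le1 x r : ball_mass x r <= 1.
Proof. by rewrite -lee_fin -ball_massE probability_le1. Qed.

(** Balls may stick out of [0, 1], whereas the self-similarity of [nu] is stated inside it. *)
Lemma measure_restrict_itv01 (A : set (measurableTypeR R)) : measurable A ->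
  nu A = nu (A `&` `[0, 1]).
Proof.
move=> mA; have [nu01 _] := nuB.
have nuC : nu (~` `[0, 1]) = 0%E.
  by rewrite probability_setC // nu01 subee.
rewrite (measureDI nu mA (measurable_itv `[0, 1])) [X in (X + _)%E](_ : _ = 0%E) ?add0e //.
apply/eqP; rewrite -measure_le0 -nuC; apply: le_measure; rewrite ?inE; last by move=> ? [].
  by apply: measurableD.
exact: measurableC.
Qed.

(** Comparing only inside [0, 1] allows balls centred outside to be bounded by balls around 0 and
    1. *)
Lemma ball_mass_mono x r x' r' :
  `[x - r, x + r] `&` `[0, 1] `<=` `[x' - r', x' + r'] ->
  ball_mass x r <= ball_mass x' r'.
Proof.
move=> sub; rewrite -lee_fin -!ball_massE measure_restrict_itv01 //.
by apply: le_measure => //; rewrite inE //; exact: measurableI.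
Qed.

Lemma ball_mass_mono_radius x r r' : r <= r' -> ball_mass x r <= ball_mass x r'.
Proof.
move=> rr'; apply: ball_mass_mono => z /= []; rewrite !in_itv /= => /andP[? ?] _.
by apply/andP; split; lra.
Qed.

Lemma ball_mass_full x r : x - r <= 0 -> 1 <= x + r -> ball_mass x r = 1.
Proof.
move=> x0 x1; apply/eqP; rewrite eq_le ball_mass_le1 -lee_fin -ball_massE.
rewrite -[leLHS]nuB.1; apply: le_measure; rewrite ?inE // => z /=.
by rewrite !in_itv /= => /andP[? ?]; apply/andP; split; lra.
Qed.

Lemma ball_mass_out x r : x + r < 0 \/ 1 < x - r -> ball_mass x r = 0.
Proof.
move=> out; apply/EFin_inj; rewrite -ball_massE measure_restrict_itv01 //.
rewrite (_ : _ `&` _ = set0) ?measure0 // -subset0 => z /= [].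
by rewrite !in_itv /= => /andP[? ?] /andP[? ?]; case: out; lra.
Qed.

(** Self-similarity for balls: each branch maps the ball to one of radius r / t cut off to [0, 1],
    and cutting off loses no mass. *)
Lemma ball_mass_split x r : ball_mass x r =
  2^-1 * ball_mass (x / t) (r / t) + 2^-1 * ball_mass ((x - (1 - t)) / t) (r / t).
Proof.
have /andP[t0 t1] := t01; have t_neq0 : t != 0 by rewrite gt_eqF.
apply/EFin_inj; rewrite EFinD !EFinM -!ball_massE measure_restrict_itv01 //.
rewrite (nuB.2 (`[x - r, x + r] `&` `[0, 1])); [|exact: measurableI|by move=> ? []].
(* Both branches have the form w / t + p, with p = 0 or p = 1 - 1/t, and the second interval is the
   preimage of [0, 1]. The last set says that the preimage point lies in [0, 1]; it is absorbed
   afterwards. *)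
have img (p : R) : (fun w => t^-1 * w + p) @`
    ((`[x - r, x + r] `&` `[0, 1]) `&` `[- p * t, (1 - p) * t]) =
    `[x / t + p - r / t, x / t + p + r / t] `&` `[0, 1] `&` [set z | 0 <= t * (z - p) <= 1].
  apply/seteqP; split=> [_ /= [w [[]]] + + + <-|z /= [[]]];
    rewrite !in_itv /= => /andP[a1 a2] /andP[b1 b2] /andP[c1 c2].
    have wE : t * (t^-1 * w + p - p) = w by field.
    rewrite wE b1 b2; do !split; apply/andP; split=> //.
    - by rewrite -subr_ge0 (_ : _ - _ = (w - (x - r)) / t) ?divr_ge0 //; [lra|lra|field].
    - by rewrite -subr_ge0 (_ : _ - _ = (x + r - w) / t) ?divr_ge0 //; [lra|lra|field].
    - by rewrite (_ : _ + p = (w - - p * t) / t) ?divr_ge0 //; [lra|lra|field].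
    - by rewrite -subr_ge0 (_ : _ - _ = ((1 - p) * t - w) / t) ?divr_ge0 //; [lra|lra|field].
  exists (t * (z - p)); last by field.
  rewrite !in_itv /= c1 c2; split; [split|] => //; apply/andP; split.
  - by rewrite -subr_ge0 (_ : _ - _ = t * (z - (x / t + p - r / t))) ?mulr_ge0 //; [lra|lra|field].
  - by rewrite -subr_ge0 (_ : _ - _ = t * (x / t + p + r / t - z)) ?mulr_ge0 //; [lra|lra|field].
  - by rewrite -subr_ge0 (_ : _ - _ = t * z) ?mulr_ge0 //; [lra|ring].
  - by rewrite -subr_ge0 (_ : _ - _ = t * (1 - z)) ?mulr_ge0 //; [lra|lra|ring].
congr (_ * _ + _ * _)%E; rewrite [RHS]measure_restrict_itv01 //; congr (nu _).
- rewrite (_ : g0 t = fun w => t^-1 * w + 0); last by apply/funext => w; rewrite addr0.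
  have := img 0; rewrite oppr0 mul0r !addr0 mul1r /dom_g0 => ->.
  apply: setIidl => z /= []; rewrite !in_itv /= => _ /andP[z0 z1].
  by apply/andP; split; nra.
- rewrite (_ : g1 t = fun w => t^-1 * w + (1 - t^-1)); last by apply/funext => w; rewrite addrA.
  have := img (1 - t^-1).
  have -> : - (1 - t^-1) * t = 1 - t by field.
  have -> : (1 - (1 - t^-1)) * t = 1 by field.
  have -> : x / t + (1 - t^-1) = (x - (1 - t)) / t by field.
  rewrite /dom_g1 => ->.
  apply: setIidl => z /= []; rewrite !in_itv /= => _ /andP[z0 z1].
  have -> : t * (z - (1 - t^-1)) = t * z + 1 - t by field.
  by apply/andP; split; nra.
Qed.

(** The factor (1 - t) / 2 keeps the second ball, centred at - (1 - t) / t, left of 0; only the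
    first carries mass, so each step halves it. *)
Lemma ball_mass_end0 n : ball_mass 0 ((1 - t) / 2 * t ^+ n) <= 2^-1 ^+ n.
Proof.
have /andP[t0 t1] := t01; have t_neq0 : t != 0 by rewrite gt_eqF.
elim: n => [|n IH]; first by rewrite expr0 ball_mass_le1.
rewrite ball_mass_split mul0r exprSr mulrA mulfK // [X in _ + 2^-1 * X]ball_mass_out ?mulr0 ?addr0.
  by rewrite exprS ler_pM2l // invr_gt0.
left; rewrite sub0r mulNr addrC subr_lt0.
have tn1 : t ^+ n <= 1 by rewrite exprn_ile1 ?ltW.
have tn0 : 0 < t ^+ n by rewrite exprn_gt0.
have tn1t : t ^+ n * t <= 1 by rewrite -exprSr exprn_ile1 ?ltW.
by rewrite ltr_pdivlMr //; nra.
Qed.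

Lemma ball_mass_end1 n : ball_mass 1 ((1 - t) / 2 * t ^+ n) <= 2^-1 ^+ n.
Proof.
have /andP[t0 t1] := t01; have t_neq0 : t != 0 by rewrite gt_eqF.
elim: n => [|n IH]; first by rewrite expr0 ball_mass_le1.
rewrite ball_mass_split exprSr mulrA mulfK // subKr divff //.
rewrite [X in 2^-1 * X + _]ball_mass_out ?mulr0 ?add0r.
  by rewrite exprS ler_pM2l // invr_gt0.
right; rewrite ltrBrDr ltr_pdivlMr //.
have tn1 : t ^+ n <= 1 by rewrite exprn_ile1 ?ltW.
have tn0 : 0 < t ^+ n by rewrite exprn_gt0.
have tn1t : t ^+ n * t <= 1 by rewrite -exprSr exprn_ile1 ?ltW.
by nra.
Qed.

Lemma ball_mass_left x r : x <= 0 -> ball_mass x r <= ball_mass 0 r.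
Proof.
move=> x0; apply: ball_mass_mono => z /= []; rewrite !in_itv /= => /andP[? ?] /andP[? ?].
by apply/andP; split; lra.
Qed.

Lemma ball_mass_right x r : 1 <= x -> ball_mass x r <= ball_mass 1 r.
Proof.
move=> x1; apply: ball_mass_mono => z /= []; rewrite !in_itv /= => /andP[? ?] /andP[? ?].
by apply/andP; split; lra.
Qed.

(* A small ball off the overlap which still meets it produces, besides the
   image of the ball, only a ball around an end point of [0, 1], whose mass
   halves at every further step. *)
Lemma ball_mass_off_overlap u n : off_overlap t u -> ~ overlap t (address_curve u t) ->
  ball_mass (address_curve u t) ((1 - t) / 2 * t ^+ n) <= n.+1%:R * 2^-1 ^+ n.
Proof.
have /andP[t0 t1] := t01; have t_neq0 : t != 0 by rewrite gt_eqF.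
elim: n u => [|n IH] u uD u0D; first by rewrite !expr0 !mulr1 ball_mass_le1.
have uSD : off_overlap t (shift 1 u) by move=> k; rewrite shift_shift; exact: uD.
have := IH _ uSD (uD 0%N).
have digit := off_overlap_digit (n := 0) t01 u0D; move: digit; rewrite shift0.
rewrite [ball_mass (address_curve u t) _]ball_mass_split [t ^+ n.+1]exprSr mulrA mulfK // exprSr.
have E0 := ball_mass_end0 n; have E1 := ball_mass_end1 n.
(* Half of (n + 1) 2^-n from the image ball plus half of 2^-n from the end-point ball gives (n + 2)
   2^-(n + 1). *)
have nE : n.+2%:R = n.+1%:R + 1 :> R by rewrite -natr1.
case d : (u 0%N) => Xu H.
- have -> : (address_curve u t - (1 - t)) / t = address_curve (shift 1 u) t.
    by rewrite (address_curveS u) // d mulr1; field.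
  have := @ball_mass_right (address_curve u t / t) ((1 - t) / 2 * t ^+ n).
  rewrite ler_pdivlMr // mul1r nE => /(_ (ltW Xu)); lra.
- have -> : address_curve u t / t = address_curve (shift 1 u) t.
    by rewrite (address_curveS u) // d mulr0; field.
  have := @ball_mass_left ((address_curve u t - (1 - t)) / t) ((1 - t) / 2 * t ^+ n).
  rewrite ler_pdivrMr // mul0r subr_le0 nE => /(_ (ltW Xu)); lra.
Qed.

(** The two images of [y] are the first shifted points of [b] and [c], both off the overlap; their
    bounds are averaged. *)
Lemma ball_mass_crossing b c y n : b 0%N = false -> c 0%N = true ->
  off_overlap t b -> off_overlap t c ->
  address_curve b t = y -> address_curve c t = y ->
  ball_mass y ((1 - t) / 2 * t ^+ n.+1) <= n.+1%:R * 2^-1 ^+ n.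
Proof.
have /andP[t0 t1] := t01; have t_neq0 : t != 0 by rewrite gt_eqF.
move=> b0 c0 bD cD bE cE.
rewrite ball_mass_split exprSr mulrA mulfK //.
have tailD k v : off_overlap t v -> off_overlap t (shift k v).
  by move=> vD j; rewrite shift_shift addnS; exact: vD.
have := ball_mass_off_overlap n (tailD 1%N _ bD) (bD 0%N).
have := ball_mass_off_overlap n (tailD 1%N _ cD) (cD 0%N).
have -> : address_curve (shift 1 b) t = y / t.
  by rewrite -bE (address_curveS b) // b0 mulr0; field.
have -> : address_curve (shift 1 c) t = (y - (1 - t)) / t.
  by rewrite -cE (address_curveS c) // c0 mulr1; field.
by lra.
Qed.

(** At least one branch keeps [x] in [0, 1], and half of the mass around that image is inherited. *)
Lemma ball_mass_ge x n : 0 <= x <= 1 -> 2^-1 ^+ n <= ball_mass x (t ^+ n).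
Proof.
have /andP[t0 t1] := t01; have t_neq0 : t != 0 by rewrite gt_eqF.
have /andP[t2 _] := t12.
elim: n x => [|n IH] x /andP[x0 x1]; first by rewrite !expr0 ball_mass_full //; lra.
rewrite ball_mass_split [t ^+ _]exprSr mulfK // exprS.
have [xt|tx] := leP x t.
  have := IH (x / t); rewrite divr_ge0 ?ler_pdivrMr ?mul1r ?(ltW t0) // => /(_ xt).
  by have := ball_mass_ge0 ((x - (1 - t)) / t) (t ^+ n); lra.
have := IH ((x - (1 - t)) / t); rewrite divr_ge0 ?ler_pdivrMr ?mul1r ?(ltW t0) //; last by lra.
have := ball_mass_ge0 (x / t) (t ^+ n) => H1 /(_ _) H2.
have : 2^-1 ^+ n <= ball_mass ((x - (1 - t)) / t) (t ^+ n) by apply: H2; lra.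
by lra.
Qed.

End BallMass.

(** * From geometric bounds on the mass [f r] to local dimension and density *)

Section LogRatio.
Variables (R : realType) (t : R) (f : R -> R).
Hypotheses (t12 : 2^-1 < t < 1) (f_mono : forall r r', r <= r' -> f r <= f r').
Hypothesis f_ge : forall n, 2^-1 ^+ n <= f (t ^+ n).
Implicit Types (r e M : R).

Let t01 : 0 < t < 1 := param01 t12.
Let lam : R := ln t^-1.
Let d : R := ln 2 / lam.

Lemma near0_ln M : \forall r \near 0^'+, 0 < r /\ M < - ln r.
Proof.
near=> r; have r0 : 0 < r by near: r; exact: nbhs_right_gt.
split=> //; rewrite ltrNr -[ltRHS]expRK ltr_ln ?posrE ?expR_gt0 //.
by near: r; apply: nbhs_right_lt; exact: expR_gt0.
Unshelve. all: end_near. Qed.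

Lemma ln_inv_gt0 : 0 < lam.
Proof.
by have /andP[t0 t1] := t01; rewrite /lam ln_gt0 // invf_gt1.
Qed.

Lemma ln_param_exp n : ln (t ^+ n) = - (n%:R * lam).
Proof.
have /andP[t0 t1] := t01.
by rewrite lnXn // /lam lnV ?posrE // mulrN opprK mulr_natl.
Qed.

Lemma ln_half_exp n : ln (2^-1 ^+ n : R) = - (n%:R * ln 2).
Proof. by rewrite lnXn ?invr_gt0 // lnV ?posrE // mulNrn mulr_natl. Qed.

Lemma ln2_gt0 : 0 < ln 2 :> R.
Proof. by rewrite ln_gt0 // ltr1n. Qed.

Lemma ln_f_ge r : 0 < r < 1 -> 0 < f r /\ - ln (f r) <= d * - ln r + ln 2.
Proof.
move=> /andP[r0 r1]; have /andP[t0 t1] := t01.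
have l0 := ln_inv_gt0; have l2 := ln2_gt0.
have L0 : 0 < - ln r by rewrite oppr_gt0 ln_lt0 // r0.
(* This choice gives t^(n + 1) < r; the rounding costs the error term [ln 2]. *)
pose n := Num.truncn (- ln r / lam).
have nle : n%:R * lam <= - ln r.
  by rewrite -ler_pdivlMr // truncn_le // divr_ge0 ?ltW.
have ltn : - ln r < n.+1%:R * lam by rewrite -ltr_pdivrMr //; exact: truncnS_gt.
have fr : 2^-1 ^+ n.+1 <= f r.
  apply: (le_trans (f_ge _)); apply: f_mono.
  by rewrite -ler_ln ?posrE ?exprn_gt0 // ln_param_exp; lra.
have h0 : 0 < 2^-1 ^+ n.+1 :> R by rewrite exprn_gt0 // invr_gt0.
have f0 := lt_le_trans h0 fr; split=> //.
have : - ln (f r) <= n.+1%:R * ln 2.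
  by rewrite lerNl -ln_half_exp ler_ln ?posrE.
move/le_trans; apply; rewrite -natr1 mulrDl mul1r lerD2r /d mulrAC ler_pdivlMr //.
by rewrite mulrAC mulrC ler_pM2l.
Qed.

Lemma log_ratio_le r : 0 < r < 1 -> ln (f r) / ln r <= d + ln 2 / - ln r.
Proof.
move=> r01; have [_ H] := ln_f_ge r01; have /andP[r0 r1] := r01.
have L0 : 0 < - ln r by rewrite oppr_gt0 ln_lt0 // r0.
have -> : ln (f r) / ln r = - ln (f r) / - ln r by rewrite invrN mulrNN.
rewrite ler_pdivrMr // mulrDl divfK ?gt_eqF //.
Qed.

(** The lower mass bound holds around every point of [0, 1], so this makes [d] maximal. *)
Lemma log_ratio_lim_le l : ln (f r) / ln r @[r --> 0^'+] --> l -> l <= d.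
Proof.
move=> fl; apply/ler_addgt0Pr => e e0.
apply: (cvgr_to_le fl); near=> r.
have [r0] : 0 < r /\ ln 2 / e < - ln r by near: r; exact: near0_ln.
rewrite ltr_pdivrMr // => Lbig.
have L0 : 0 < - ln r by rewrite -(pmulr_lgt0 _ e0); have := ln2_gt0; lra.
have r1 : 0 < r < 1 by rewrite r0 /= ltNge; apply/negP => /ln_ge0; lra.
apply: (le_trans (log_ratio_le r1)); rewrite lerD2l ler_pdivrMr //; lra.
Unshelve. all: end_near. Qed.

Variable a : R.
Hypotheses (a01 : 0 < a < 1)
  (f_le : forall n, f (a * t ^+ n.+1) <= n.+1%:R * 2^-1 ^+ n).

(** Makes the factor n + 1 of the mass bound harmless: its logarithm is of order at most the square
    root of - ln r. *)
Lemma ln_le_sqrt (x : R) : 0 < x -> ln x <= 2 * Num.sqrt x.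
Proof.
move=> x0; have s0 : 0 < Num.sqrt x by rewrite sqrtr_gt0.
rewrite -{1}[x](sqr_sqrtr (ltW x0)) lnXn // mulr2n mulrDl mul1r.
by have := ln_sublinear s0; lra.
Qed.

Lemma ln_f_le r : 0 < r -> - ln a + lam <= - ln r ->
  d * - ln r - (d * - ln a + 2 * ln 2 + 2 * Num.sqrt (- ln r / lam)) <= - ln (f r).
Proof.
move=> r0 rsmall; have /andP[t0 t1] := t01; have /andP[a0 a1] := a01.
have l0 := ln_inv_gt0; have l2 := ln2_gt0.
have A0 : 0 < - ln a by rewrite oppr_gt0 ln_lt0.
have r1 : 0 < r < 1.
  by rewrite r0 /= ltNge; apply/negP => /ln_ge0; lra.
have [f0 _] := ln_f_ge r1.
(* [k] is the largest index with r <= a t^k; the smallness of r gives k >= 1, so [f_le] applies with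
   [m] = k - 1. *)
pose k := Num.truncn ((- ln r + ln a) / lam).
have q1 : 1 <= (- ln r + ln a) / lam by rewrite ler_pdivlMr //; lra.
have kle : k%:R * lam <= - ln r + ln a.
  by rewrite -ler_pdivlMr // truncn_le //; lra.
have ltk : - ln r + ln a < k.+1%:R * lam.
  by rewrite -ltr_pdivrMr //; exact: truncnS_gt.
have : (0 < k)%N by rewrite truncn_gt0.
case: k kle ltk => // m kle ltk _.
have fr : f r <= m.+1%:R * 2^-1 ^+ m.
  apply: le_trans (f_le _); apply: f_mono.
  rewrite -ler_ln ?posrE ?mulr_gt0 ?exprn_gt0 // lnM ?posrE ?exprn_gt0 // ln_param_exp.
  by lra.
have h0 : 0 < 2^-1 ^+ m :> R by rewrite exprn_gt0 // invr_gt0.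
have : ln (f r) <= ln m.+1%:R - m%:R * ln 2.
  by rewrite -ln_half_exp -lnM ?posrE ?ltr0n // ler_ln ?posrE // mulr_gt0 ?ltr0n.
have lnm : ln (m.+1%:R : R) <= 2 * Num.sqrt (- ln r / lam).
  apply: (le_trans (ln_le_sqrt _)); first by rewrite ltr0n.
  rewrite ler_pM2l // ler_wsqrtr // ler_pdivlMr //; lra.
have dm : d * (- ln r + ln a) <= (m%:R + 2) * ln 2.
  rewrite /d mulrAC ler_pdivrMr // mulrC [leRHS]mulrAC ler_pM2r //.
  by apply/ltW; move: ltk; rewrite -!natr1; lra.
by lra.
Qed.

Lemma log_ratio_cvg : ln (f r) / ln r @[r --> 0^'+] --> d.
Proof.
have /andP[a0 a1] := a01; have l0 := ln_inv_gt0; have l2 := ln2_gt0.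
have A0 : 0 < - ln a by rewrite oppr_gt0 ln_lt0.
have d0 : 0 < d by rewrite divr_gt0.
(* Once - ln r is at least 1, [K] times its square root dominates all error terms; - ln r > (K /
   e)^2 pushes this below e times - ln r. *)
pose K := d * - ln a + 2 * ln 2 + 2 * Num.sqrt lam^-1.
have K0 : 0 < K.
  by rewrite ltr_wpDr ?mulr_ge0 ?sqrtr_ge0 // addr_gt0 // mulr_gt0.
apply/cvgrPdist_le => e e0.
near=> r.
have [r0] : 0 < r /\ 1 + (- ln a) + lam + (K / e) ^+ 2 < - ln r.
  by near: r; exact: near0_ln.
set L := - ln r => Lbig; have Ke0 : 0 <= (K / e) ^+ 2 by exact: sqr_ge0.
have L0 : 0 < L by lra.
have s0 : 0 < Num.sqrt L by rewrite sqrtr_gt0.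
have LE : L = Num.sqrt L ^+ 2 by rewrite sqr_sqrtr // ltW.
have s1 : 1 <= Num.sqrt L by rewrite -[leLHS]sqrtr1 ler_wsqrtr //; lra.
have r1 : 0 < r < 1.
  by rewrite r0 /= ltNge; apply/negP => /ln_ge0; rewrite -/L; rewrite /L in L0; lra.
have KL : K <= e * Num.sqrt L.
  have Ke : 0 <= K / e by rewrite divr_ge0 // ltW.
  rewrite mulrC -ler_pdivrMr // -[leLHS](ger0_norm Ke) -sqrtr_sqr.
  by rewrite ler_wsqrtr //; lra.
have [_ up] := ln_f_ge r1.
have low := @ln_f_le r r0; rewrite -/L sqrtrM ?(ltW L0) // in low up.
have {}low : d * L - K * Num.sqrt L <= - ln (f r).
  apply: le_trans (low _); last by lra.
  rewrite lerD2l lerN2 /K 2!mulrDl; have s10 : 0 <= Num.sqrt L - 1 by lra.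
  have H1 : 0 <= d * - ln a by rewrite mulr_ge0 ?ltW.
  by have := mulr_ge0 H1 s10; have := mulr_ge0 (ltW l2) s10; lra.
have {}up : - ln (f r) <= d * L + K * Num.sqrt L.
  apply: (le_trans up); rewrite lerD2l; apply: (@le_trans _ _ K).
    have H1 : 0 <= d * - ln a by rewrite mulr_ge0 ?ltW.
    by have := sqrtr_ge0 lam^-1; rewrite /K; lra.
  by rewrite ler_peMr // ltW.
have -> : ln (f r) / ln r = - ln (f r) / L by rewrite /L invrN mulrNN.
have KsL : K * Num.sqrt L <= e * L.
  by rewrite {2}LE expr2 mulrA ler_pM2r.
rewrite ler_norml; apply/andP; split.
  by rewrite lerBrDr addrC -lerBrDr opprK ler_pdivrMr // mulrDl; lra.
by rewrite lerBlDr addrC -lerBlDr ler_pdivlMr // mulrBl; lra.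
Unshelve. all: end_near. Qed.

(** Since t > 1/2, [d] exceeds 1. With h = (d - 1) / 2 the mass is at most r^(1 + h) for small r, so
    the quotient is of order r^h. *)
Lemma density_of_log_ratio : f r / (2 * r) @[r --> 0^'+] --> 0.
Proof.
have /andP[t0 t1] := t01; have l0 := ln_inv_gt0; have l2 := ln2_gt0.
have d1 : 1 < d.
  rewrite ltr_pdivlMr // mul1r ltr_ln ?posrE ?invr_gt0 //.
  by have /andP[? ?] := t12; rewrite -[ltRHS]invrK ltf_pV2 ?posrE // invr_gt0.
pose h := (d - 1) / 2.
have h0 : 0 < h by rewrite divr_gt0 // subr_gt0.
apply/cvgr0Pnorm_le => e e0.
have /cvgrPdist_le /(_ h h0) near_d := log_ratio_cvg.
near=> r.
have [r0] : 0 < r /\ 1 + `|ln e / h| < - ln r by near: r; exact: near0_ln.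
have := ler_norm (- (ln e / h)); rewrite normrN.
set L := - ln r => eh Lbig.
have L0 : 0 < L by have := normr_ge0 (ln e / h); lra.
have r1 : 0 < r < 1.
  by rewrite r0 /= ltNge; apply/negP => /ln_ge0; rewrite -/L; rewrite /L in L0; lra.
have [f0 _] := ln_f_ge r1.
have : `|d - ln (f r) / ln r| <= h by near: r.
have -> : ln (f r) / ln r = - ln (f r) / L by rewrite /L invrN mulrNN.
rewrite ler_norml => /andP[_]; rewrite lerBlDr addrC -lerBlDr ler_pdivlMr // => H.
have fle : ln (f r) <= ln r + ln e.
  have : - (ln e / h) * h <= L * h by rewrite ler_pM2r //; lra.
  rewrite mulNr divfK ?gt_eqF // => H'.
  have dh : d = 1 + 2 * h by rewrite /h; field.
  by move: H; rewrite dh /L in H' *; lra.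
have : f r <= e * r.
  by rewrite -ler_ln ?posrE ?mulr_gt0 // lnM ?posrE //; lra.
have fr0 : 0 <= f r / (2 * r) by rewrite ltW // divr_gt0 // mulr_gt0.
rewrite (ger0_norm fr0) ler_pdivrMr ?mulr_gt0 //.
by have := mulr_gt0 e0 r0; lra.
Unshelve. all: end_near. Qed.

End LogRatio.

(** * Assembly of both directions from the results on addresses, crossings and masses *)

Theorem proposition15 (R : realType) :
  (forall (b c : seq01) (t y : R),
     nonperiodic_kneading R b -> nonperiodic_kneading R c ->
     two_address_crossing b c t y ->
     exactly_two_addresses t y /\
     (forall nu : probability (measurableTypeR R) R,
        bernoulli_convolution t nu ->
        [/\ has_local_dimension nu y (ln 2 / ln t^-1),
            (forall x d : R, 0 <= x <= 1 -> has_local_dimension nu x d ->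
               d <= ln 2 / ln t^-1)
          & has_density nu y 0]))
  /\
  (forall t y : R, 2^-1 < t < 1 -> overlap t y -> exactly_two_addresses t y ->
     exists b c : seq01,
       [/\ two_address_crossing b c t y,
           nonperiodic_kneading R b \/ (y = t /\ b = half_low)
         & nonperiodic_kneading R c \/ (y = 1 - t /\ c = half_high)]).
Proof.
split=> [b c t y _ _ [[b0 c0] /andP[t2 _] [/andP[_ t1] bc _] yE yN]|t y t12 yD two].
  have t12 : 2^-1 < t < 1 by rewrite t2.
  have t01 := param01 t12; have /andP[t0 _] := t01.
  have cE : address_curve c t = y by rewrite yE.
  have bE : address_curve b t = y by [].
  have bD := (no_returnP y t12).1 yN _ bE; have cD := (no_returnP y t12).1 yN _ cE.
  split=> [|nu nuB]; first exact: (exactly_two_addresses_off_overlap t12 b0 c0 bD cD).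
  have mass_ge x n : 0 <= x <= 1 -> 2^-1 ^+ n <= ball_mass nu x (t ^+ n).
    exact: ball_mass_ge.
  have mass_mono x := ball_mass_mono_radius nuB x.
  have y01 : 0 <= y <= 1 by rewrite yE address_curve_ge0 ?address_curve_le1.
  have a01 : 0 < (1 - t) / 2 < 1 by apply/andP; split; lra.
  have mass_le n := ball_mass_crossing t12 nuB n b0 c0 bD cD bE cE.
  split=> [|x d x01|].
  - exact: (log_ratio_cvg t12 (mass_mono y) (mass_ge y ^~ y01) a01 mass_le).
  - exact: (log_ratio_lim_le t12 (mass_mono x) (mass_ge x ^~ x01)).
  - exact: (density_of_log_ratio t12 (mass_mono y) (mass_ge y ^~ y01) a01 mass_le).
have [yN [b [c [b0 c0 bE cE]]]] := exactly_two_addresses_inv t12 yD two.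
have t01 := param01 t12; have /andP[t2 t1] := t12; have /overlapE/andP[yl yr] := yD.
have bD := (no_returnP y t12).1 yN _ bE; have cD := (no_returnP y t12).1 yN _ cE.
exists b, c; split.
- split=> //; first by rewrite t2 (crossing_le_t2 t12 b0 c0 bD cD) // bE cE.
  split=> [//||s /andP[s2 st]]; first by rewrite bE cE.
  by apply: (no_earlier_crossing t12 _ yD b0 c0 bD cD bE cE); apply/andP; split; lra.
- have [ylt|yge] := ltP y t.
    by left; apply: (kneading_off_overlap t12 b0 _ _ bD); rewrite bE.
  have yt : y = t by apply/eqP; rewrite eq_le yr.
  by right; split=> //; apply: (address_curve_eq_t t01 b0); rewrite bE.
(* The symmetry x -> 1 - x turns [c] into a sequence with first digit 0 and the end point 1 - t into
   t. *)
- have cc0 : compl01 c 0%N = false by rewrite /compl01 c0.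
  have ccE : address_curve (compl01 c) t = 1 - y by rewrite address_curve_compl // cE.
  have [ygt|yle] := ltP (1 - t) y.
    left; apply/kneading_compl/(kneading_off_overlap t12 cc0).
    + by rewrite ccE overlap_compl.
    + by rewrite ccE; lra.
    + exact: off_overlap_compl.
  have yt : y = 1 - t by apply/eqP; rewrite eq_le yle.
  right; split=> //; rewrite -[c]compl01K (address_curve_eq_t t01 cc0); last by rewrite ccE; lra.
  by apply/funext => -[|n].
Qed.
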